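(* Let $P$ be any finite poset. Then $R_r(P)\cong R_2(P\times Q_{r-1})$ (as $K$-algebras) for all $r\ge2$.
   Context: $K$ is a field. For a finite poset $P=\{p_1,\ldots,p_n\}$ and $r\ge1$ let $S=K[x_{ij} : 1\le i\le r,\ 1\le j\le n]$. A poset ideal of $P$ is a down-closed subset (possibly empty). For each multichain $\mathcal I: I_1\subseteq\cdots\subseteq I_r=P$ of poset ideals of $P$ (with $I_0=\emptyset$) put $u_{\mathcal I}=\prod_{j=1}^r\prod_{p_k\in I_j\setminus I_{j-1}}x_{jk}$. $R_r(P)$ is the $K$-subalgebra of $S$ generated by all the monomials $u_{\mathcal I}$. $Q_m$ denotes the poset $[m]=\{1,\ldots,m\}$ with its usual order. The direct product $P\times Q$ of posets has the product of the underlying sets as underlying set, with $(p,q)\le(p',q')$ iff $p\le p'$ and $q\le q'$. *)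

(* Defs.v *)
From HB Require Import structures.
From mathcomp Require Import all_boot all_order all_algebra.
From mathcomp Require Import boolp.
From mathcomp Require Import mpoly.

Set Implicit Arguments.
Unset Strict Implicit.
Unset Printing Implicit Defensive.

Import Order.TTheory GRing.Theory.
Local Open Scope ring_scope.

Section GeneratedSubalgebra.
Variables (K : fieldType) (A : comAlgType K) (G : A -> Prop).

Definition gen_subalg : {pred A} := fun x =>
  `[< forall S : {pred A},
        GRing.subalg_closed S -> (forall g, G g -> g \in S) -> x \in S >].

Lemma gen_subalg_closed : GRing.subalg_closed gen_subalg.
Proof.
split.
- by apply/asboolP => S [].
- move=> a u v /asboolP uG /asboolP vG; apply/asboolP => S SA GS.
  by case: (SA) => _ + _; apply; [apply: uG | apply: vG].
- move=> u v /asboolP uG /asboolP vG; apply/asboolP => S SA GS.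
  by case: (SA) => _ _; apply; [apply: uG | apply: vG].
Qed.

HB.instance Definition _ := GRing.isSubalgClosed.Build K A gen_subalg
  (GRing.subalg_closed_semi gen_subalg_closed).

Record subalg_of := Subalg { subalg_val : A; _ : subalg_val \in gen_subalg }.

HB.instance Definition _ := [isSub for subalg_val].
HB.instance Definition _ := [Choice of subalg_of by <:].
HB.instance Definition _ := [SubChoice_isSubAlgebra of subalg_of by <:].
HB.instance Definition _ := [SubNzRing_isSubComNzRing of subalg_of by <:].

End GeneratedSubalgebra.

Definition alg_isomorphic (K : fieldType) (A B : algType K) : Prop :=
  exists f : {lrmorphism A -> B}, bijective f.

Section MultichainRing.
Variables (d : Order.disp_t) (P : finPOrderType d) (r : nat).

Definition poset_ideal (I : {set P}) : Prop :=
  forall p q : P, (p <= q)%O -> q \in I -> p \in I.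

(* The index set is {0, ..., r}, so that the convention I_0 = set0 is part of
   the data. *)
Definition multichain (I : 'I_r.+1 -> {set P}) : Prop :=
  [/\ forall j, poset_ideal (I j),
      {homo I : i j / (i <= j)%N >-> i \subset j},
      I ord0 = set0
    & I ord_max = [set: P]].

Variable K : fieldType.

(* K[x_(j, p)], the variables being numbered by enum_rank. *)
Definition mc_poly : comAlgType K := {mpoly K[#|{: 'I_r * P}|]}.

Definition mc_var (j : 'I_r) (p : P) : mc_poly := 'X_(enum_rank (j, p)).

(* j : 'I_r stands for the step j+1, which runs from I_j to I_(j+1). *)
Definition mc_monomial (I : 'I_r.+1 -> {set P}) : mc_poly :=
  \prod_(j < r)
    \prod_(p in I (lift ord0 j) :\: I (widen_ord (leqnSn r) j)) mc_var j p.

Definition mc_ring : comAlgType K :=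
  subalg_of (fun u : mc_poly => exists2 I, multichain I & u = mc_monomial I).

End MultichainRing.

Arguments mc_ring {d} P r K.

(* Main.v *)
Require Import Defs.
From HB Require Import structures.
From mathcomp Require Import all_boot all_order all_algebra.
From mathcomp Require Import boolp.
From mathcomp Require Import mpoly.
From mathcomp Require Import zify.

Set Implicit Arguments.
Unset Strict Implicit.
Unset Printing Implicit Defensive.

Import Order.TTheory GRing.Theory.
Local Open Scope ring_scope.

(** The ring R_r(P), with r = s + 1, is sent onto R_2(P x Q_s) by the monomial
    substitution x_(j, p) |-> prod_k y_(t(j, k), (p, k)), where, with all
    indices counted from 0, t(j, k) is 1 if s <= j + k and 0 otherwise.

    A multichain of ideals I_0 = set0, ..., I_r = P is the same thing as an
    order preserving level function l : P -> {0, ..., r - 1}, with p in I_i iff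
    l(p) < i, and its monomial is the product of the x_(l(p), p)
    (mc_generatorP).  The substitution sends this product to the one attached
    to the level function (p, k) |-> t(l(p), k) of P x Q_s (chain_map_level).
    Every order preserving h : P x Q_s -> {0, 1} arises in this way, from
    l(p) = sum_k h(p, k) (threshold_surj).  So generators are sent onto
    generators.

    The substitution is injective on the whole polynomial ring.  As it sends
    monomials to monomials, it is enough that it be injective on exponents
    (monomial_map_inj).  The exponents of the y_(0, (p, k)) are the sums of the
    exponents of the x_(j, p) over j < s - k, and adding the exponent of
    y_(1, (p, 0)) to that of y_(0, (p, 0)) gives the sum over all j; this last
    step needs 0 < s.  These are all the nonempty prefix sums of the exponents
    of the x_(j, p), which therefore can be recovered (weight_inj).  An
    injective algebra morphism that maps generators onto generators induces an
    isomorphism of the generated subalgebras (alg_isomorphic_subalg). *)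

(** * Morphisms between generated subalgebras *)

Lemma mem_gen_subalg (K : fieldType) (A : comAlgType K) (G : A -> Prop) x :
  G x -> x \in gen_subalg G.
Proof. by move=> Gx; apply/asboolP => S _; apply. Qed.

Section SubalgebraMorphism.
Variables (K : fieldType) (A B : comAlgType K) (G : A -> Prop) (H : B -> Prop).
Variable f : {lrmorphism A -> B}.

Hypothesis fGH : forall x, G x -> H (f x).

Lemma gen_subalg_morph (x : A) : x \in gen_subalg G -> f x \in gen_subalg H.
Proof.
move=> /asboolP Gx.
apply: (Gx [pred y | f y \in gen_subalg H]) => [|g /fGH Hg]; last first.
  by rewrite inE; apply: mem_gen_subalg.
have [H1 HZ HM] := gen_subalg_closed H.
split=> [|a u v|u v]; rewrite !inE ?rmorph1 // => Hu Hv.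
  by rewrite linearP; apply: HZ.
by rewrite rmorphM; apply: HM.
Qed.

(** The morphism between the generated subalgebras induced by [f]. *)
Definition subalg_map (x : subalg_of G) : subalg_of H :=
  Subalg (gen_subalg_morph (valP x)).

Lemma subalg_map_linear : linear subalg_map.
Proof. by move=> a x y; apply: val_inj; rewrite /= !linearP. Qed.

Lemma subalg_map_monoid_morphism : monoid_morphism subalg_map.
Proof.
by split=> [|x y]; apply: val_inj; rewrite /= ?rmorph1 ?rmorphM.
Qed.

HB.instance Definition _ :=
  GRing.isLinear.Build K (subalg_of G) (subalg_of H) *:%R subalg_map
    subalg_map_linear.
HB.instance Definition _ :=
  GRing.isMonoidMorphism.Build (subalg_of G) (subalg_of H) subalg_map
    subalg_map_monoid_morphism.

Hypothesis f_inj : injective f.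
Hypothesis fHG : forall y, H y -> exists2 x, G x & y = f x.

Lemma gen_subalg_lift (y : B) :
  y \in gen_subalg H -> exists2 x, x \in gen_subalg G & f x = y.
Proof.
move=> /asboolP Hy.
have := Hy [pred y | `[< exists2 x, x \in gen_subalg G & f x = y >]].
rewrite !inE => Sy; apply/asboolP; apply: Sy => [|h /fHG[x Gx ->]]; last first.
  by rewrite inE; apply/asboolP; exists x => //; apply: mem_gen_subalg.
have [G1 GZ GM] := gen_subalg_closed G.
split=> [|a u v|u v]; rewrite !inE.
- by apply/asboolP; exists 1; rewrite ?rmorph1.
- move=> /asboolP[x Gx <-] /asboolP[y' Gy <-]; apply/asboolP.
  by exists (a *: x + y'); rewrite ?linearP //; apply: GZ.
- move=> /asboolP[x Gx <-] /asboolP[y' Gy <-]; apply/asboolP.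
  by exists (x * y'); rewrite ?rmorphM //; apply: GM.
Qed.

Lemma alg_isomorphic_subalg : alg_isomorphic (subalg_of G) (subalg_of H).
Proof.
exists subalg_map.
have lift (y : subalg_of H) : exists x, subalg_map x == y.
  have [x Gx fx] := gen_subalg_lift (valP y).
  by exists (Subalg Gx); apply/eqP/val_inj.
exists (fun y => xchoose (lift y)) => y; last exact/eqP/(xchooseP (lift y)).
apply: val_inj; apply: f_inj.
by have /eqP/(congr1 val) := xchooseP (lift (subalg_map y)).
Qed.

End SubalgebraMorphism.

(** * Monomial substitutions *)

Section MonomialMap.
Variables (K : fieldType) (n k : nat) (w : 'I_n -> 'X_{1..k}).

(** The substitution of the monomial of exponent [w i] for the [i]-th
    variable. *)
Definition monomial_map : {mpoly K[n]} -> {mpoly K[k]} :=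
  comp_mpoly [tuple 'X_[w i] | i < n].

HB.instance Definition _ := GRing.LRMorphism.on monomial_map.

(** The action of [monomial_map] on exponents. *)
Definition mnm_map (m : 'X_{1..n}) : 'X_{1..k} :=
  (\big[mnm_add/0]_(i < n) (w i *+ m i))%MM.

Lemma monomial_mapX m : monomial_map 'X_[m] = 'X_[mnm_map m].
Proof.
rewrite /monomial_map comp_mpolyX /mnm_map -mprodXE.
by apply: eq_bigr => i _; rewrite tnth_mktuple mpolyXn.
Qed.

Lemma monomial_mapXU i : monomial_map 'X_i = 'X_[w i].
Proof. by rewrite /monomial_map comp_mpolyXU -tnth_nth tnth_mktuple. Qed.

Lemma monomial_mapE p :
  monomial_map p = \sum_(m <- msupp p) p@_m *: 'X_[mnm_map m].
Proof.
rewrite /monomial_map comp_mpolyEX; apply: eq_bigr => m _.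
by rewrite -monomial_mapX.
Qed.

Lemma mcoeff_monomial_map m p :
  injective mnm_map -> (monomial_map p)@_(mnm_map m) = p@_m.
Proof.
move=> w_inj; rewrite monomial_mapE [p in RHS]mpolyE !raddf_sum /=.
by apply: eq_bigr => m' _; rewrite !mcoeffZ !mcoeffX (inj_eq w_inj).
Qed.

Lemma monomial_map_inj : injective mnm_map -> injective monomial_map.
Proof.
move=> w_inj p q pq; apply/mpolyP => m.
by rewrite -!(mcoeff_monomial_map _ _ w_inj) pq.
Qed.

End MonomialMap.

(** * Multichains of ideals as level functions *)

Section Levels.
Variables (d : Order.disp_t) (P : finPOrderType d) (K : fieldType) (r : nat).

(** The monomial attached to a level function; see [mc_monomial_level]. *)
Definition level_monomial (l : P -> 'I_r) : mc_poly P r K :=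
  \prod_p mc_var K (l p) p.

Lemma mc_monomial_level (I : 'I_r.+1 -> {set P}) (l : P -> 'I_r) :
  (forall p i, (p \in I i) = (l p < i)%N) ->
  mc_monomial K I = level_monomial l.
Proof.
move=> Il; rewrite /mc_monomial /level_monomial (exchange_big_dep xpredT) //=.
apply: eq_bigr => p _; rewrite (big_pred1 (l p)) // => j.
by rewrite !inE !Il lift0 /= ltnS -leqNgt -eqn_leq.
Qed.

(** The level of [p] is the step, counted from 0, at which [p] enters the
    multichain. *)
Lemma multichain_level (I : 'I_r.+1 -> {set P}) :
  multichain I -> exists l : P -> 'I_r, forall p i, (p \in I i) = (l p < i)%N.
Proof.
case=> _ Imono I0 Imax.
suff lP p : exists j : 'I_r, [forall i : 'I_r.+1, (p \in I i) == (j < i)%N].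
  exists (fun p => xchoose (lP p)) => p i.
  by apply/eqP; move/forallP: (xchooseP (lP p)).
have [i pi i_min] : {i : 'I_r.+1 | p \in I i &
    forall i', p \in I i' -> (i <= i')%N}.
  have pmax : p \in I ord_max by rewrite Imax inE.
  case: (arg_minnP (P := fun i => p \in I i) (@nat_of_ord _) pmax) => i.
  by exists i.
have i_gt0 : (0 < i)%N.
  rewrite lt0n; apply/eqP => i0; move: pi.
  by rewrite (_ : i = ord0) ?I0 ?inE //; apply: val_inj.
have i_lt : (i.-1 < r)%N by rewrite -ltnS prednK.
exists (Ordinal i_lt); apply/forallP => i'; rewrite /= prednK //.
apply/eqP; apply/idP/idP => [/i_min//|/Imono/subsetP]; exact.
Qed.

(** Multichains correspond to order preserving level functions. *)
Lemma mc_generatorP (u : mc_poly P r K) :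
  (exists2 I, multichain I & u = mc_monomial K I) <->
  (exists2 l : P -> 'I_r, {homo l : p q / (p <= q)%O >-> (p <= q)%N} &
     u = level_monomial l).
Proof.
split=> [[I Imc ->]|[l l_mono ->]].
  have [l Il] := multichain_level Imc; exists l; last exact: mc_monomial_level.
  move=> p q pq; rewrite leqNgt; apply/negP => qp.
  have [Iid _ _ _] := Imc.
  have := Iid (widen_ord (leqnSn r) (l p)) _ _ pq.
  by rewrite !Il /= ltnn qp => /(_ isT).
pose I (i : 'I_r.+1) := [set p | (l p < i)%N].
exists I; last by rewrite (mc_monomial_level (l := l)) // => p i; rewrite inE.
split.
- move=> i p q pq; rewrite !inE; exact/leq_ltn_trans/l_mono.
- by move=> i j ij; apply/subsetP => p; rewrite !inE => /leq_trans; apply.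
- by apply/setP => p; rewrite !inE.
- by apply/setP => p; rewrite !inE ltn_ord.
Qed.

End Levels.

(** * The substitution for the product with a chain *)

Lemma eq_from_prefix_sums r (a b : 'I_r -> nat) :
  (forall i, (i <= r)%N ->
     \sum_(j < r | (j < i)%N) a j = \sum_(j < r | (j < i)%N) b j)%N ->
  a =1 b.
Proof.
have split_sum (c : 'I_r -> nat) (i : 'I_r) :
    (\sum_(j < r | (j < i.+1)%N) c j = c i + \sum_(j < r | (j < i)%N) c j)%N.
  rewrite (bigD1 i) //=; congr (_ + _)%N; apply: eq_bigl => j.
  by rewrite ltnS ltn_neqAle andbC.
move=> ab i; have := ab _ (ltn_ord i).
by rewrite !split_sum (ab i (ltnW (ltn_ord i))) => /addIn.
Qed.

Lemma sum_leq_ord n i : (\sum_(k < n) (i <= k) = n - i)%N.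
Proof.
elim: n => [|n IHn]; first by rewrite big_ord0.
by rewrite big_ord_recr /= IHn; case: leqP; lia.
Qed.

Section ProductWithChain.
Variables (K : fieldType) (d : Order.disp_t) (P : finPOrderType d) (s : nat).

(** The level of [(p, k)] in the product with the chain, if [p] is at level [j]:
    the ideal of the product consists of the [(p, k)] with [j + k < s], that is,
    with [p] in the ideal [I_(s - k)] of the multichain in [P]. *)
Definition threshold (j : 'I_s.+1) (k : 'I_s) : 'I_2 :=
  if (s <= j + k)%N then ord_max else ord0.

(** The exponent of the image of [x_(j, p)]. *)
Definition var_image (j : 'I_s.+1) (p : P) :
    'X_{1..#|{: 'I_2 * (P *p 'I_s)%type}|} :=
  (\sum_(k < s) U_(enum_rank (threshold j k, (p, k))))%MM.

(** [var_image] in terms of the rank of the variable [x_(j, p)]. *)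
Definition weight (i : 'I_#|{: 'I_s.+1 * P}|) :=
  var_image (enum_val i).1 (enum_val i).2.

Lemma var_imageE j p c q k :
  var_image j p (enum_rank (c, (q, k))) =
  ((threshold j k == c) && (p == q)) :> nat.
Proof.
rewrite /var_image mnm_sumE (bigD1 k) //= big1 => [|k' k'k]; rewrite mnm1E.
  rewrite (inj_eq enum_rank_inj) xpair_eqE [X in _ && X]xpair_eqE.
  by rewrite eqxx andbT addn0.
rewrite (inj_eq enum_rank_inj) xpair_eqE [X in _ && X]xpair_eqE.
by rewrite (negPf k'k) !andbF.
Qed.

Lemma mnm_map_weightE m c p k :
  mnm_map weight m (enum_rank (c, (p, k))) =
  (\sum_(j < s.+1 | threshold j k == c) m (enum_rank (j, p)))%N.
Proof.
rewrite /mnm_map mnm_sumE.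
under eq_bigr do rewrite mulmnE /weight var_imageE mulnbl.
rewrite -big_mkcond (reindex enum_rank) /=; last first.
  exact/onW_bij/enum_rank_bij.
under eq_bigl do rewrite enum_rankK.
rewrite (eq_bigr (fun x => m (enum_rank (x.1, x.2)))); last by case.
rewrite -(pair_big (fun j => threshold j k == c) (fun q => q == p)
            (fun j q => m (enum_rank (j, q)))) /=.
by apply: eq_bigr => j _; rewrite big_pred1_eq.
Qed.

(** The exponents of the image determine all the prefix sums of the original
    exponents.  If [s = 0], the substitution sends every variable to 1. *)
Lemma weight_inj : (0 < s)%N -> injective (mnm_map weight).
Proof.
move=> s_gt0 m1 m2 eq_m; apply/mnmP => x.
rewrite -[x]enum_valK; case: (enum_val x) => j p {x}.
apply: (eq_from_prefix_sums (a := fun j => m1 (enum_rank (j, p)))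
                            (b := fun j => m2 (enum_rank (j, p)))) => i i_le.
have sumE c k : (\sum_(j < s.+1 | threshold j k == c) m1 (enum_rank (j, p)) =
                 \sum_(j < s.+1 | threshold j k == c) m2 (enum_rank (j, p)))%N.
  by rewrite -!mnm_map_weightE eq_m.
have [->|i_gt0] := posnP i; first by rewrite !big_pred0.
have [->|i_neq] := eqVneq i s.+1.
  (* The sum over all levels: both variables at (p, 0) are needed. *)
  rewrite (eq_bigl xpredT) => [|j']; last exact: ltn_ord.
  rewrite [RHS](eq_bigl xpredT) => [|j']; last exact: ltn_ord.
  pose low (j' : 'I_s.+1) := threshold j' (Ordinal s_gt0) == ord0.
  rewrite (bigID low) [RHS](bigID low) /= /low.
  have th1 j' k : (threshold j' k != ord0) = (threshold j' k == ord_max).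
    by rewrite /threshold; case: ifP.
  rewrite sumE; congr (_ + _)%N.
  by under eq_bigl do rewrite th1; under [RHS]eq_bigl do rewrite th1.
have i_le_s : (i <= s)%N by rewrite -ltnS ltn_neqAle i_neq.
(* The variable at level 0 over (p, s - i) gives the prefix sum up to i. *)
have k_lt : (s - i < s)%N by rewrite ltn_subrL i_gt0.
have th0 (j' : 'I_s.+1) : (j' < i)%N = (threshold j' (Ordinal k_lt) == ord0).
  rewrite /threshold /=; case: (leqP s) => ji; last by rewrite eqxx; lia.
  by rewrite (_ : _ == _ = false) //; lia.
by under eq_bigl do rewrite th0; under [RHS]eq_bigl do rewrite th0.
Qed.

(** The substitution that maps [R_(s+1)(P)] onto [R_2(P x Q_s)]. *)
Definition chain_map : mc_poly P s.+1 K -> mc_poly (P *p 'I_s)%type 2 K :=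
  monomial_map weight.

HB.instance Definition _ := GRing.LRMorphism.on chain_map.

Lemma chain_map_level (l : P -> 'I_s.+1) :
  chain_map (level_monomial K l) =
  level_monomial K (fun q : (P *p 'I_s)%type => threshold (l q.1) q.2).
Proof.
rewrite /level_monomial rmorph_prod /=.
transitivity (\prod_p \prod_k
  mc_var K (threshold (l p) k) ((p, k) : (P *p 'I_s)%type)).
  apply: eq_bigr => p _; rewrite /mc_var /chain_map monomial_mapXU /weight.
  by rewrite enum_rankK /= /var_image -mprodXE.
by rewrite pair_big; apply: eq_bigr => -[].
Qed.

Lemma threshold_homo (l : P -> 'I_s.+1) :
  {homo l : p q / (p <= q)%O >-> (p <= q)%N} ->
  {homo (fun q : (P *p 'I_s)%type => threshold (l q.1) q.2) :
     p q / (p <= q)%O >-> (p <= q)%N}.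
Proof.
move=> l_mono [p k] [q k'] /andP[/= /l_mono lpq kk'].
have {}kk' : (k <= k')%N by [].
rewrite /threshold /=.
by case: (leqP s (l p + k)); case: (leqP s (l q + k')) => //=; lia.
Qed.

(** As [h (p, -)] is nondecreasing with values in {0, 1}, it is determined by
    the number [l p] of its ones, which are at the last [l p] elements of the
    chain. *)
Lemma threshold_surj (h : (P *p 'I_s)%type -> 'I_2) :
  {homo h : p q / (p <= q)%O >-> (p <= q)%N} ->
  exists2 l : P -> 'I_s.+1, {homo l : p q / (p <= q)%O >-> (p <= q)%N} &
    forall q, h q = threshold (l q.1) q.2.
Proof.
move=> h_mono.
have h_le1 q : (h q <= 1)%N by rewrite -ltnS.
have sum_lt p : (\sum_(k < s) h (p, k) < s.+1)%N.
  rewrite ltnS; apply: leq_trans (leq_sum _ _) _ => [k _|]; first exact: h_le1.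
  by rewrite sum1_card card_ord.
exists (fun p => Ordinal (sum_lt p)) => [p q pq|[p k]] /=.
  apply: leq_sum => k _; apply: h_mono.
  by rewrite Order.ProdOrder.leEprod /= pq lexx.
apply: val_inj; rewrite /threshold /=; set N := (\sum_(k' < s) _)%N.
have h_chain (k1 k2 : 'I_s) : (k1 <= k2)%N -> (h (p, k1) <= h (p, k2))%N.
  by move=> k12; apply: h_mono; rewrite Order.ProdOrder.leEprod /= lexx.
case: (posnP (h (p, k))) => [hk0|hk_gt0].
  have : (N <= \sum_(k' < s) (k < k'))%N.
    apply: leq_sum => k' _; case: (ltnP k k') => [_|/h_chain].
      exact: h_le1.
    by rewrite hk0.
  rewrite sum_leq_ord hk0 => sum_le.
  by case: (leqP s) => //=; have := ltn_ord k; lia.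
have : (\sum_(k' < s) (k <= k') <= N)%N.
  by apply: leq_sum => k' _; case: (leqP k k') => // /h_chain; apply: leq_trans.
rewrite sum_leq_ord => sum_ge.
have -> : h (p, k) = 1%N :> nat by apply/eqP; rewrite eqn_leq h_le1.
by case: (leqP s) => //=; have := ltn_ord k; lia.
Qed.

End ProductWithChain.

(* 'I_n carries the usual order, and *p is the product order. *)
Theorem theorem4p3 (K : fieldType) (d : Order.disp_t) (P : finPOrderType d)
    (r : nat) (hr : (2 <= r)%N) :
  alg_isomorphic (mc_ring P r K) (mc_ring (P *p 'I_r.-1)%type 2 K).
Proof.
case: r hr => [//|s]; rewrite ltnS => s_gt0.
apply: (@alg_isomorphic_subalg _ _ _ _ _ (@chain_map K d P s)).
- move=> u /mc_generatorP[l l_mono ->]; apply/mc_generatorP.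
  by eexists; last exact: chain_map_level; exact: threshold_homo.
- exact/monomial_map_inj/weight_inj.
- move=> v /mc_generatorP[h h_mono ->].
  have [l l_mono hl] := threshold_surj h_mono.
  exists (level_monomial K l); first by apply/mc_generatorP; exists l.
  by rewrite /= chain_map_level; apply: eq_bigr => q _; rewrite hl.
Qed.
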